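(* Let $\delta\in(0,1)$ and $n\in\mathbb N$. There is a measure $\mu_n^*\in S_\delta$ for which $$M_{n,\delta}=|\phi_n(1,\mu_n^* )| .$$
   Context: $\mathbb T$ is the unit circle, identified with $(-\pi,\pi]$ via $\theta\mapsto e^{i\theta}$. For $\delta\in(0,1)$ the Steklov class $S_\delta$ is the set of probability measures $\sigma$ on $\mathbb T$ such that $\sigma'(\theta)\ge \delta/(2\pi)$ at every Lebesgue point of $\sigma$ (equivalently a.e.), where $\sigma'$ is the density of the absolutely continuous part of $\sigma$ with respect to $d\theta$. For $\sigma\in S_\delta$, $\phi_n(z,\sigma)=\lambda_n z^n+\ldots$, $\lambda_n>0$, are the polynomials orthonormal with respect to $\sigma$: $\int_{\mathbb T}\phi_n\overline{\phi_m}\,d\sigma=\delta_{n,m}$ (Kronecker delta). Define $M_{n,\delta}=\sup_{\sigma\in S_\delta}\|\phi_n(z,\sigma)\|_{L^\infty(\mathbb T)}$; by rotation invariance of $S_\delta$ this equals $\sup_{\sigma\in S_\delta}|\phi_n(1,\sigma)|$. *)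

(* Defs.v *)
From HB Require Import structures.
From mathcomp Require Import all_boot all_order all_algebra.
From mathcomp Require Import complex.
From mathcomp Require Import all_classical all_reals all_analysis.

Set Implicit Arguments.
Unset Strict Implicit.
Unset Printing Implicit Defensive.

Import Order.TTheory GRing.Theory Num.Theory.
Import numFieldNormedType.Exports.

Local Open Scope classical_set_scope.
Local Open Scope ring_scope.
Local Open Scope complex_scope.

(* The unit circle is identified with ]-pi, pi] via theta |-> exp(i theta); a
   measure on the circle is a Borel measure on R carried by that interval. *)
Definition circle (R : realType) : set (measurableTypeR R) :=
  [set` `](- pi : R), pi]].
Arguments circle R : clear implicits.

Lemma measurable_circle (R : realType) : measurable (circle R).
Proof. exact: measurable_itv. Qed.
Arguments measurable_circle R : clear implicits.

Definition expi (R : realType) (t : R) : R[i] := cos t +i* sin t.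

Definition arc_length (R : realType) :
    {measure set (measurableTypeR R) -> \bar R} :=
  mrestr lebesgue_measure (measurable_circle R).
Arguments arc_length R : clear implicits.

Definition mutually_singular d (T : measurableType d) (R : realType)
    (mu nu : {measure set T -> \bar R}) :=
  exists2 N : set T, measurable N & (mu N = 0 /\ nu (~` N) = 0)%E.

(* f is the density of the absolutely continuous part in the Lebesgue
   decomposition of sigma with respect to d theta; f is unique up to equality
   almost everywhere. *)
Definition is_ac_density (R : realType)
    (sigma : {measure set (measurableTypeR R) -> \bar R})
    (f : measurableTypeR R -> R) :=
  [/\ measurable_fun setT f, forall t, 0 <= f t &
    exists2 nu : {measure set (measurableTypeR R) -> \bar R},
      mutually_singular nu (arc_length R) &
      forall A, measurable A ->
        (sigma A = \int[arc_length R]_(t in A) (f t)%:E + nu A)%E].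

Definition steklov (R : realType) (delta : R) :
    set (probability (measurableTypeR R) R) :=
  [set sigma : probability (measurableTypeR R) R | sigma (circle R) = 1%E /\
    exists2 f : measurableTypeR R -> R, is_ac_density sigma f &
      {ae arc_length R, forall t, delta / (2 * pi) <= f t}].

Definition circle_integral (R : realType)
    (sigma : {measure set (measurableTypeR R) -> \bar R}) (F : R[i] -> R[i]) :
    R[i] :=
  Rintegral sigma (circle R) (fun t => complex.Re (F (expi t))) +i*
  Rintegral sigma (circle R) (fun t => complex.Im (F (expi t))).

(* The order on R[i] is partial: 0 < lead_coef says that the leading
   coefficient is real and positive. *)
Definition is_orthonormal_polys (R : realType)
    (sigma : {measure set (measurableTypeR R) -> \bar R})
    (phi : nat -> {poly R[i]}) :=
  (forall n, size (phi n) = n.+1 /\ 0 < lead_coef (phi n)) /\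
  (forall n m, circle_integral sigma (fun z => (phi n).[z] * ((phi m).[z])^*)
               = (n == m)%:R).

(* The sequence is unique when it exists, which it does as soon as sigma has
   infinite support, hence on every Steklov class (delta > 0). *)
Definition orthonormal_poly (R : realType)
    (sigma : {measure set (measurableTypeR R) -> \bar R}) :
    nat -> {poly R[i]} :=
  xget (fun=> 0) [set phi | is_orthonormal_polys sigma phi].

Definition Linfty_norm (R : realType) (F : R[i] -> R[i]) : \bar R :=
  Lnorm (arc_length R) +oo%E
    (fun t => (ComplexField.Normc.normc (F (expi t)))%:E).

Definition steklov_sup (R : realType) (n : nat) (delta : R) : \bar R :=
  ereal_sup [set Linfty_norm (horner (orthonormal_poly sigma n))
            | sigma in steklov delta].

(* Main.v *)
Require Import Defs.
From HB Require Import structures.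
From mathcomp Require Import all_boot all_order all_algebra.
From mathcomp Require Import spectral complex ring lra.
From mathcomp Require Import all_classical all_reals all_analysis.
From mathcomp Require Import measurable_realfun ess_sup_inf.

(** The value of [|phi_n(1, sigma)|] depends on [sigma] only through its
    moments of order at most [n], so the supremum over the Steklov class, an
    infinite-dimensional set, is really one over a compact set of matrices.

    Let [H(sigma)] be the Toeplitz matrix of the moments of [sigma]
    ([moment_mx]).  For [sigma] in the Steklov class, [sigma] dominates
    [delta / (2 pi)] times arc length, whose moment matrix is a multiple of the
    identity by Parseval, so [H(sigma) - delta] is positive semidefinite and
    [H(sigma)] has unit diagonal ([steklov_moment_mx]).  The predicate
    [steklov_mx] collects these conditions, and [last_orthonormal T a] says that
    [a] is the coefficient vector of [phi_n], up to a factor of modulus one, in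
    terms of the moment matrix [T] alone.  The pairs [(T, a)] satisfying both
    form a closed set, which is bounded because [T >= delta] turns
    [a T a^* = 1] into [|a|^2 <= 1 / delta]; hence some pair maximizes the
    modulus of [sum_j a_j], the value of the polynomial at [1]
    ([extremal_pair]).  Conjugating [T] by the diagonal unitary matrix of the
    powers of [z] moves the value at a point [z] of the circle to [1], so the
    same pair bounds the polynomials on the whole circle
    ([extremal_pair_circle]).

    It remains to realize the maximizing [T] by a measure.  The matrix
    [(T - delta) / (1 - delta)] is a positive semidefinite Toeplitz matrix, and
    by the Caratheodory-Toeplitz theorem ([toeplitz_psd_spectral]) such a matrix
    is the moment matrix of finitely many point masses on the circle: written as
    a Gram matrix, the Toeplitz symmetry says that the shift of the vectors
    preserves inner products, so it extends to a unitary matrix, whose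
    eigenvalues are the nodes.  Adding [delta / (2 pi)] times arc length gives
    the extremal measure ([steklov_realization]).  Since its orthonormal
    polynomial has coefficient vector [a] up to a factor of modulus one
    ([last_orthonormal_unique]), its value at [1] is the maximum, and by
    continuity that value is also at most the essential supremum of
    [|phi_n|], so that it is the supremum of the statement. *)

Set Implicit Arguments.
Unset Strict Implicit.
Unset Printing Implicit Defensive.

Import Order.TTheory GRing.Theory Num.Theory Num.Def.
Import numFieldNormedType.Exports.
Local Open Scope classical_set_scope.
Local Open Scope ring_scope.
Local Open Scope sesquilinear_scope.

(** * Gram matrices and unitary maps *)

Section GramMatrices.
Variable C : numClosedFieldType.

Lemma trmxC_mul m n p (A : 'M[C]_(m, n)) (B : 'M[C]_(n, p)) :
  (A *m B)^t* = B^t* *m A^t*.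
Proof. by rewrite trmx_mul map_mxM. Qed.

Lemma gram_row0E n (x : 'rV[C]_n) : (x *m x^t*) 0 0 = \sum_i `|x 0 i| ^+ 2.
Proof. by rewrite mxE; apply: eq_bigr => i _; rewrite !mxE normCK. Qed.

Lemma gram_eq0 m n (A : 'M[C]_(m, n)) : A *m A^t* = 0 -> A = 0.
Proof.
move=> A0; apply/row_matrixP => i; rewrite row0; apply/rowP => j.
have : (row i A *m (row i A)^t*) 0 0 = 0.
  transitivity ((A *m A^t*) i i); last by rewrite A0 mxE.
  by rewrite !mxE; apply: eq_bigr => k _; rewrite !mxE.
rewrite gram_row0E => /eqP; rewrite psumr_eq0 => [|k _]; last first.
  by rewrite exprn_ge0.
by move=> /allP/(_ j); rewrite mem_index_enum sqrf_eq0 normr_eq0 !mxE => /(_ isT)/eqP.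
Qed.

(** The rows of [X *m B] have the same inner products as those of [X *m A], so
    equal Gram matrices force the same linear relations between the rows. *)
Lemma gram_mulmx0 m n p (A B : 'M[C]_(m, n)) (X : 'M[C]_(p, m)) :
  A *m A^t* = B *m B^t* -> X *m A = 0 -> X *m B = 0.
Proof.
move=> AB XA; apply: gram_eq0; rewrite trmxC_mul mulmxA -(mulmxA X) -AB.
by rewrite mulmxA XA !mul0mx.
Qed.

Lemma gram_rank m n (A B : 'M[C]_(m, n)) :
  A *m A^t* = B *m B^t* -> \rank A = \rank B.
Proof.
move=> AB; have eqker : \rank (kermx A) = \rank (kermx B).
  apply/eqP; rewrite eqn_leq !mxrankS//; apply/sub_kermxP.
    by apply: gram_mulmx0 (mulmx_ker B).
  by apply: gram_mulmx0 (mulmx_ker A).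
move: eqker; rewrite !mxrank_ker => eqker.
by rewrite -(subKn (rank_leq_row A)) eqker subKn// rank_leq_row.
Qed.

(** Orthonormalizing the space of all vectors orthogonal to [A] completes its
    rows to a spanning family; this is what makes room for a unitary extension
    when [A] is rank-deficient. *)
Lemma orthonormal_complement m n (A : 'M[C]_(m, n)) :
  exists H : 'M[C]_(n - \rank A, n),
    [/\ H *m H^t* = 1%:M, A *m H^t* = 0 & row_full (col_mx A H)].
Proof.
have rK : \rank (kermx (A^t*)) = (n - \rank A)%N.
  by rewrite mxrank_ker mxrank_map mxrank_tr.
rewrite -rK; set K := kermx _; pose H := schmidt (row_base K).
have HU : H *m H^t* = 1%:M.
  by apply/unitarymxP/schmidt_unitarymx; rewrite rank_leq_col.
have HK : (H :=: K)%MS.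
  apply: eqmx_trans (eq_row_base K).
  by apply: eqmx_schmidt_free; rewrite row_base_free.
have HA0 : H *m A^t* = 0 by apply/sub_kermxP; rewrite HK.
exists H; split => //.
  by rewrite -(trmxCK (A *m _)) trmxC_mul trmxCK HA0 trmx0 map_mx0.
rewrite /row_full -mxrank_tr -(mxrank_map conjC) -/(row_free _) -kermx_eq0.
rewrite tr_col_mx map_row_mx.
set L := kermx _; have /eqP : L *m row_mx (A^t*) (H^t*) = 0 by exact: mulmx_ker.
rewrite mul_mx_row row_mx_eq0 => /andP[/eqP LA /eqP LH].
have /submxP[Y LY] : (L <= H)%MS by rewrite HK; apply/sub_kermxP.
by move: LH; rewrite LY -mulmxA HU mulmx1 => ->; rewrite mul0mx.
Qed.

(** An inner-product preserving correspondence between two families of vectors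
    extends to a unitary map.  Complete both families by orthonormal vectors,
    equally many because the ranks agree.  The completed families span, have the
    same Gram matrix, and so determine the map, which is unitary because it
    preserves inner products on a spanning family. *)
Lemma unitary_of_gram m n (A B : 'M[C]_(m, n)) :
  A *m A^t* = B *m B^t* -> exists2 U : 'M[C]_n, U \is unitarymx & A *m U = B.
Proof.
move=> AB.
have [H [HH AH Afull]] := orthonormal_complement A.
have [K [KK BK _]] := orthonormal_complement B.
rewrite -(gram_rank AB) in K KK BK.
pose A' := col_mx A H; pose B' := col_mx B K.
have HA : H *m A^t* = 0 by rewrite -(trmxCK (H *m _)) trmxC_mul trmxCK AH trmx0 map_mx0.
have KB : K *m B^t* = 0 by rewrite -(trmxCK (K *m _)) trmxC_mul trmxCK BK trmx0 map_mx0.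
have A'B' : A' *m A'^t* = B' *m B'^t*.
  rewrite /A' /B' !tr_col_mx !map_row_mx !mul_col_row.
  by rewrite AB HH KK HA KB AH BK.
have A'U : A' *m (pinvmx A' *m B') = B'.
  apply/eqP; rewrite -subr_eq0 mulmxA -{2}(mul1mx B') -mulmxBl; apply/eqP.
  by apply: gram_mulmx0 A'B' _; rewrite mulmxBl mul1mx mulmxKpV// subrr.
exists (pinvmx A' *m B').
  apply/unitarymxP; set U := pinvmx A' *m B' in A'U *.
  have : A' *m (U *m U^t* - 1%:M) *m A'^t* = 0.
    rewrite mulmxBr mulmxBl mulmx1 mulmxA -mulmxA -trmxC_mul A'U.
    by rewrite A'B' subrr.
  set D := _ - _ => AD.
  have pA : pinvmx A' *m A' = 1%:M by rewrite mulVpmx.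
  have : D = 0.
    have := congr1 (fun X => pinvmx A' *m X *m (pinvmx A')^t*) AD.
    rewrite mulmx0 mul0mx !mulmxA pA mul1mx -mulmxA -trmxC_mul pA.
    by rewrite trmx1 map_mx1 mulmx1.
  by move/eqP; rewrite subr_eq0 => /eqP.
by move: A'U; rewrite mul_col_mx => /eq_col_mx[].
Qed.

Definition psdmx n (T : 'M[C]_n) := forall x : 'rV_n, 0 <= (x *m T *m x^t*) 0 0.

(** The square root comes from the spectral theorem, the eigenvalues being
    nonnegative as values of the quadratic form. *)
Lemma psdmx_factor n (T : 'M[C]_n) : T^t* = T -> psdmx T ->
  exists M : 'M[C]_n, T = M *m M^t*.
Proof.
move=> hT psdT.
have /orthomx_spectralP TE : T \is normalmx by apply/normalmxP; rewrite hT.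
set P := spectralmx T in TE; set D := spectral_diag T in TE.
have PU : P \is unitarymx by exact: spectral_unitarymx.
have DE : P *m T *m P^t* = diag_mx D.
  by rewrite TE invmx_unitary// !mulmxA (unitarymxP PU) mul1mx mulmxtVK.
have D_ge0 i : 0 <= D 0 i.
  have := psdT (row i P); rewrite -row_mul.
  have -> : (row i (P *m T) *m (row i P)^t*) 0 0 = (P *m T *m P^t*) i i.
    by rewrite !mxE; apply: eq_bigr => k _; rewrite !mxE.
  by rewrite DE mxE eqxx.
pose S := diag_mx (map_mx sqrtC D).
exists (P^t* *m S); rewrite trmxC_mul trmxCK mulmxA -(mulmxA _ S).
have -> : S *m S^t* = diag_mx D.
  rewrite /S tr_diag_mx map_diag_mx mulmx_diag; congr diag_mx.
  apply/rowP => i; rewrite !mxE.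
  by rewrite [X in _ * X]geC0_conj ?sqrtC_ge0// -expr2 sqrtCK.
by rewrite [LHS]TE invmx_unitary.
Qed.

(** The Caratheodory-Toeplitz theorem.  Write [T] as the Gram matrix of vectors
    [v_0, ..., v_n].  The Toeplitz condition says that [v_0, ..., v_(n-1)] and
    [v_1, ..., v_n] have the same Gram matrix, so a unitary [U] sends [v_k] to
    [v_(k+1)] and [T k l] is the inner product of [v_0 U^k] and [v_0 U^l].  In an
    eigenbasis of [U] this is a sum over the eigenvalues [z_j], weighted by the
    squared moduli of the coordinates of [v_0]. *)
Lemma toeplitz_psd_spectral n (T : 'M[C]_n.+1) :
  T^t* = T -> psdmx T ->
  (forall i j : 'I_n, T (lift ord0 i) (lift ord0 j) =
     T (widen_ord (leqnSn n) i) (widen_ord (leqnSn n) j)) ->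
  exists (z : 'I_n.+1 -> C) (w : 'I_n.+1 -> C),
    [/\ forall j, `|z j| = 1, forall j, 0 <= w j &
        forall k l : 'I_n.+1, T k l = \sum_j w j * (z j ^+ k * (z j ^+ l)^*)].
Proof.
move=> hT psdT toepT.
have [M TM] := psdmx_factor hT psdT.
have TE k l : T k l = (row k M *m (row l M)^t*) 0 0.
  by rewrite TM !mxE; apply: eq_bigr => i _; rewrite !mxE.
pose A : 'M[C]_(n, n.+1) := \matrix_(i < n) row (widen_ord (leqnSn n) i) M.
pose B : 'M[C]_(n, n.+1) := \matrix_(i < n) row (lift ord0 i) M.
have [|U UU AU] := @unitary_of_gram _ _ A B.
  apply/matrixP => i j; have := toepT i j; rewrite !TE !mxE => E.
  transitivity (T (widen_ord (leqnSn n) i) (widen_ord (leqnSn n) j)).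
    by rewrite TE mxE; apply: eq_bigr => k _; rewrite !mxE.
  by rewrite -toepT TE mxE; apply: eq_bigr => k _; rewrite !mxE.
have /orthomx_spectralP UE : U \is normalmx.
  apply/normalmxP; rewrite (unitarymxP UU).
  by rewrite -(invmx_unitary UU) mulVmx// unitarymx_unit.
set P := spectralmx U in UE; set Z := spectral_diag U in UE.
have PU : P \is unitarymx by exact: spectral_unitarymx.
have PP : P *m P^t* = 1%:M by apply/unitarymxP.
have PP' : P^t* *m P = 1%:M by rewrite -(invmx_unitary PU) mulVmx// unitarymx_unit.
have ZE : P *m U *m P^t* = diag_mx Z.
  by rewrite UE invmx_unitary// !mulmxA PP mul1mx mulmxtVK.
have Z1 j : `|Z 0 j| = 1.
  have : (diag_mx Z *m (diag_mx Z)^t*) j j = 1.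
    rewrite -ZE !trmxC_mul trmxCK !mulmxA -(mulmxA _ _ P) PP' mulmx1.
    by rewrite -(mulmxA P) (unitarymxP UU) mulmx1 PP mxE eqxx.
  rewrite tr_diag_mx map_diag_mx mulmx_diag !mxE eqxx mulr1n -normCK => /eqP.
  by rewrite sqrp_eq1// => /eqP.
(* [y] is [v_0] in the eigenbasis of [U], where [U] acts by the [Z 0 j]. *)
pose y := row 0 M *m P^t*.
have rowM k : (k < n.+1)%N ->
  row (inord k) M *m P^t* = \row_j (y 0 j * Z 0 j ^+ k).
  elim: k => [_|k IHk kn].
    apply/rowP => j; rewrite mxE expr0 mulr1 /y.
    by congr ((row _ M *m _) 0 j); apply: val_inj; rewrite /= inordK.
  have -> : row (inord k.+1) M = row (inord k) M *m U.
    have := congr1 (row (Ordinal (kn : (k < n)%N))) AU.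
    rewrite row_mul !rowK => /esym.
    have -> : lift ord0 (Ordinal (kn : (k < n)%N)) = inord k.+1.
      by apply: val_inj; rewrite /= inordK.
    by have -> : widen_ord (leqnSn n) (Ordinal (kn : (k < n)%N)) = inord k
      by apply: val_inj; rewrite /= inordK// ltnW.
  rewrite -(mulmx1 (row _ M)) -PP' -!mulmxA [P *m (U *m _)]mulmxA ZE mulmxA IHk 1?ltnW//.
  by apply/rowP => j; rewrite mul_mx_diag !mxE exprSr mulrA.
exists (fun j => Z 0 j), (fun j => `|y 0 j| ^+ 2); split=> [|j|k l];
  [exact: Z1|exact: exprn_ge0|].
have /esym Ek : inord k = k by apply: val_inj; rewrite /= inordK.
have /esym El : inord l = l by apply: val_inj; rewrite /= inordK.
have -> : T k l = ((row k M *m P^t*) *m (row l M *m P^t*)^t*) 0 0.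
  by rewrite trmxC_mul trmxCK mulmxA -(mulmxA _ _ P) PP' mulmx1 TE.
rewrite {1}Ek {1}El !rowM// mxE.
apply: eq_bigr => j _; rewrite !mxE rmorphM/= normCK.
by rewrite mulrACA.
Qed.

End GramMatrices.

(** * Continuity of complex-valued maps *)

Lemma conjcE (R : rcfType) (z : R[i]) : conjc z = Num.conj z.
Proof. by []. Qed.

Lemma norm_normc (R : rcfType) (z : R[i]) : `|z| = (ComplexField.Normc.normc z)%:C%C.
Proof. by []. Qed.

Section ComplexContinuity.
Variables (R : realType) (X : topologicalType).

(** Continuity for the topology of the plane, read off the real and imaginary
    parts. *)
Definition ccontinuous (F : X -> R[i]) :=
  continuous (fun x => complex.Re (F x)) /\ continuous (fun x => complex.Im (F x)).

Lemma ccontinuous_cst c : ccontinuous (fun=> c).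
Proof. by split => x; exact: cvg_cst. Qed.

Lemma Re_addc (z w : R[i]) : complex.Re (z + w) = complex.Re z + complex.Re w.
Proof. by case: z; case: w. Qed.

Lemma Im_addc (z w : R[i]) : complex.Im (z + w) = complex.Im z + complex.Im w.
Proof. by case: z; case: w. Qed.

Lemma Re_mulc (z w : R[i]) : complex.Re (z * w) =
  complex.Re z * complex.Re w - complex.Im z * complex.Im w.
Proof. by case: z; case: w. Qed.

Lemma Im_mulc (z w : R[i]) : complex.Im (z * w) =
  complex.Re z * complex.Im w + complex.Im z * complex.Re w.
Proof. by case: z; case: w. Qed.

Lemma Re_conjc (z : R[i]) : complex.Re (z^*) = complex.Re z.
Proof. by case: z. Qed.

Lemma Im_conjc (z : R[i]) : complex.Im (z^*) = - complex.Im z.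
Proof. by case: z. Qed.

Lemma ccontinuousD F G : ccontinuous F -> ccontinuous G ->
  ccontinuous (fun x => F x + G x).
Proof.
move=> [F1 F2] [G1 G2]; split => x.
  by under eq_fun do rewrite Re_addc; apply: cvgD; [exact: F1|exact: G1].
by under eq_fun do rewrite Im_addc; apply: cvgD; [exact: F2|exact: G2].
Qed.

Lemma ccontinuousM F G : ccontinuous F -> ccontinuous G ->
  ccontinuous (fun x => F x * G x).
Proof.
move=> [F1 F2] [G1 G2]; split => x.
  under eq_fun do rewrite Re_mulc; apply: cvgB; apply: cvgM;
    [exact: F1|exact: G1|exact: F2|exact: G2].
under eq_fun do rewrite Im_mulc; apply: cvgD; apply: cvgM;
  [exact: F1|exact: G2|exact: F2|exact: G1].
Qed.

Lemma ccontinuousJ F : ccontinuous F -> ccontinuous (fun x => (F x)^*).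
Proof.
move=> [F1 F2]; split => x.
  by under eq_fun do rewrite Re_conjc; exact: F1.
by under eq_fun do rewrite Im_conjc; apply: cvgN; exact: F2.
Qed.

Lemma ccontinuous_sum (J : finType) (F : J -> X -> R[i]) :
  (forall j, ccontinuous (F j)) -> ccontinuous (fun x => \sum_j F j x).
Proof.
move=> cF; elim: (index_enum J) => [|j s IHs].
  by under eq_fun do rewrite big_nil; exact: ccontinuous_cst.
by under eq_fun do rewrite big_cons; exact: ccontinuousD.
Qed.

Lemma ccontinuous_normc F : ccontinuous F ->
  continuous (fun x => ComplexField.Normc.normc (F x)).
Proof.
move=> [F1 F2] x.
have -> : (fun x => ComplexField.Normc.normc (F x)) =
   (fun x => Num.sqrt (complex.Re (F x) ^+ 2 + complex.Im (F x) ^+ 2)).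
  by apply/funext => y; case: (F y).
apply: continuous_comp; last exact: sqrt_continuous.
by apply: cvgD; apply: cvgM; [exact: F1|exact: F1|exact: F2|exact: F2].
Qed.

Lemma closed_ceq F G : ccontinuous F -> ccontinuous G ->
  closed [set x | F x = G x].
Proof.
move=> [F1 F2] [G1 G2].
have -> : [set x | F x = G x] =
   (fun x => complex.Re (F x) - complex.Re (G x)) @^-1` [set 0] `&`
   (fun x => complex.Im (F x) - complex.Im (G x)) @^-1` [set 0].
  apply/seteqP; split=> x /=; first by move=> ->; rewrite !subrr.
  move=> [/eqP + /eqP]; rewrite !subr_eq0 => /eqP + /eqP.
  by case: (F x) (G x) => [a b] [c d] /= -> ->.
apply: closedI; apply: closed_comp; try exact: closed_eq; move=> x _.
  by apply: cvgB; [exact: F1|exact: G1].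
by apply: cvgB; [exact: F2|exact: G2].
Qed.

Lemma closed_cle F G : ccontinuous F -> ccontinuous G ->
  closed [set x | F x <= G x].
Proof.
move=> [F1 F2] [G1 G2].
have -> : [set x | F x <= G x] =
   (fun x => complex.Re (G x) - complex.Re (F x)) @^-1` [set y | 0 <= y] `&`
   (fun x => complex.Im (G x) - complex.Im (F x)) @^-1` [set 0].
  apply/seteqP; split=> x /=; rewrite lecE.
    by move=> /andP[/eqP -> ?]; rewrite subr_ge0 subrr.
  by move=> [+ /eqP]; rewrite subr_ge0 subr_eq0 => -> /eqP ->; rewrite eqxx.
apply: closedI; apply: closed_comp; [|exact: closed_ge| |exact: closed_eq];
  move=> x _.
  by apply: cvgB; [exact: G1|exact: F1].
by apply: cvgB; [exact: G2|exact: F2].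
Qed.

Lemma ccontinuous_mulmx m n p (A : X -> 'M[R[i]]_(m, n)) (B : X -> 'M[R[i]]_(n, p)) :
  (forall i j, ccontinuous (fun x => A x i j)) ->
  (forall i j, ccontinuous (fun x => B x i j)) ->
  forall i j, ccontinuous (fun x => (A x *m B x) i j).
Proof.
move=> cA cB i j; under eq_fun do rewrite mxE.
by apply: ccontinuous_sum => k; apply: ccontinuousM.
Qed.

Lemma closed_forall J (P : J -> X -> Prop) :
  (forall j, closed [set x | P j x]) -> closed [set x | forall j, P j x].
Proof.
move=> cP; rewrite (_ : [set x | _] = \bigcap_j [set x | P j x]).
  by apply: closed_bigI.
by apply/seteqP; split=> x /= Px j; [move=> _; exact: Px|exact: Px].
Qed.

Lemma closed_imply (b : bool) (P : X -> Prop) :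
  (b -> closed [set x | P x]) -> closed [set x | b -> P x].
Proof.
case: b => [/(_ isT) cP|_].
  have -> : [set x | true -> P x] = [set x | P x]; last exact: cP.
  by apply/seteqP; split=> x /=; [move=> /(_ isT)|].
rewrite (_ : [set x | false -> P x] = setT); first exact: closedT.
by apply/seteqP; split.
Qed.

End ComplexContinuity.

(** * An extremal moment matrix *)

Section Extremal.
Variables (R : realType) (n : nat).
Implicit Types (d : R) (T : 'M[R[i]]_n.+1) (a : 'rV[R[i]]_n.+1).

(** These conditions characterize the matrices [moment_mx sigma n] with [sigma]
    in the Steklov class; see [steklov_moment_mx] and [steklov_realization]. *)
Definition steklov_mx d T :=
  [/\ T^t* = T, T 0 0 = 1,
    forall k l k' l' : 'I_n.+1, (k + l' = k' + l)%N -> T k l = T k' l' &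
    forall x : 'rV_n.+1,
      d%:C%C * (x *m x^t*) 0 0 <= (x *m T *m x^t*) 0 0].

(** The row [a] holds the coefficients of a polynomial of degree [n] which has
    norm one and is orthogonal to the lower powers of the variable, for the inner
    product whose Gram matrix on the monomials is [T]. *)
Definition last_orthonormal T a :=
  (a *m T *m a^t*) 0 0 = 1 /\ forall j : 'I_n.+1, (j < n)%N -> (a *m T) 0 j = 0.

Lemma gram_ge0 (x : 'rV[R[i]]_n.+1) : 0 <= (x *m x^t*) 0 0.
Proof. by rewrite gram_row0E sumr_ge0// => i _; rewrite exprn_ge0. Qed.

Lemma steklov_mx_psd d T : 0 <= d -> steklov_mx d T -> psdmx T.
Proof.
move=> d0 [_ _ _ Td] x; apply: le_trans (Td x).
by rewrite mulr_ge0 ?gram_ge0// ler0c.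
Qed.

Lemma toeplitz_psd_realization T : T^t* = T -> T 0 0 = 1 ->
  (forall k l k' l' : 'I_n.+1, (k + l' = k' + l)%N -> T k l = T k' l') ->
  psdmx T ->
  exists (z w : 'I_n.+1 -> R[i]),
    [/\ forall j, `|z j| = 1, forall j, 0 <= w j, \sum_j w j = 1 &
        forall k l : 'I_n.+1, T k l = \sum_j w j * (z j ^+ k * (z j ^+ l)^*)].
Proof.
move=> hT T1 toepT psdT.
have [i j|z [w [z1 w0 TE]]] := @toeplitz_psd_spectral R[i] n T hT psdT.
  by apply: toepT; rewrite !lift0 /= addnS.
exists z, w; split => //; rewrite -T1 TE.
by apply: eq_bigr => j _; rewrite !expr0 mul1r conjC1 mulr1.
Qed.

(** By [toeplitz_psd_realization] every entry is an average of numbers of modulus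
    one. *)
Lemma steklov_mx_le1 d T k l : 0 <= d -> steklov_mx d T -> `|T k l| <= 1.
Proof.
move=> d0 Td; have psdT := steklov_mx_psd d0 Td.
case: Td => hT T1 toepT _.
have [z [w [z1 w0 w1 ->]]] := toeplitz_psd_realization hT T1 toepT psdT.
rewrite (le_trans (ler_norm_sum _ _ _))// -w1 ler_sum// => j _.
by rewrite !normrM norm_conjC !normrX z1 !expr1n !mulr1 ger0_norm.
Qed.

(** From [d * |a|^2 <= a T a^* = 1]; the bound [1 + 1 / d] is cruder than the
    square root of [1 / d] that this yields, and simpler to state. *)
Lemma last_orthonormal_bound d T a j : 0 < d -> steklov_mx d T ->
  last_orthonormal T a -> `|a 0 j| <= (1 + d^-1)%:C%C.
Proof.
move=> d0 [_ _ _ Td] [a1 _].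
have : d%:C%C * `|a 0 j| ^+ 2 <= 1.
  rewrite -a1; apply: le_trans (Td a); rewrite ler_pM2l ?ltcR//.
  by rewrite gram_row0E (bigD1 j)// lerDl sumr_ge0 // => i _; exact: exprn_ge0.
rewrite norm_normc -rmorphXn -rmorphM -[1]/(1%:C%C) !lecR.
set t := ComplexField.Normc.normc _ => dt.
have {}dt : t ^+ 2 <= d^-1 by rewrite -[leRHS]mulr1 ler_pdivlMl.
have di : 0 < d^-1 by rewrite invr_gt0.
rewrite leNgt; apply/negP => td; nra.
Qed.

Local Notation I := ((bool * 'I_n.+1 * 'I_n.+1) + (bool * 'I_n.+1))%type.
Local Notation Xn := (prod_topology (fun _ : I => R)).
(** Pairs [(T, a)] are coded by their real coordinates, as points of a product
    of copies of [R], where Tychonoff's theorem gives compactness of boxes. *)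
Let mxof (p : Xn) : 'M[R[i]]_n.+1 :=
  \matrix_(k, l) (p (inl (false, k, l)) +i* p (inl (true, k, l)))%C.
Let rowof (p : Xn) : 'rV[R[i]]_n.+1 :=
  \row_j (p (inr (false, j)) +i* p (inr (true, j)))%C.

Let code T a : Xn := fun i => match i with
  | inl (b, k, l) => if b then complex.Im (T k l) else complex.Re (T k l)
  | inr (b, j) => if b then complex.Im (a 0 j) else complex.Re (a 0 j) end.

Let mxof_code T a : mxof (code T a) = T.
Proof. by apply/matrixP => i j; rewrite mxE /=; case: (T i j). Qed.

Let rowof_code T a : rowof (code T a) = a.
Proof. by apply/rowP => j; rewrite mxE /=; case: (a 0 j). Qed.

Let continuous_coord (i : I) : continuous (fun p : Xn => p i).
Proof. exact: (@proj_continuous I (fun=> R) i). Qed.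

Let ccontinuous_mxof k l : ccontinuous (fun p => mxof p k l).
Proof.
have E p : mxof p k l = (p (inl (false, k, l)) +i* p (inl (true, k, l)))%C by rewrite mxE.
split.
  have -> : (fun p => complex.Re (mxof p k l)) = (fun p => p (inl (false, k, l))).
    by apply/funext => p; rewrite E.
  exact: continuous_coord.
have -> : (fun p => complex.Im (mxof p k l)) = (fun p => p (inl (true, k, l))).
  by apply/funext => p; rewrite E.
exact: continuous_coord.
Qed.

Let ccontinuous_rowof k l : ccontinuous (fun p => rowof p k l).
Proof.
have E p : rowof p k l = (p (inr (false, l)) +i* p (inr (true, l)))%C by rewrite mxE.
split.
  have -> : (fun p => complex.Re (rowof p k l)) = (fun p => p (inr (false, l))).
    by apply/funext => p; rewrite E.
  exact: continuous_coord.
have -> : (fun p => complex.Im (rowof p k l)) = (fun p => p (inr (true, l))).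
  by apply/funext => p; rewrite E.
exact: continuous_coord.
Qed.

Let ccontinuous_rowofJ k l : ccontinuous (fun p => ((rowof p)^t*) k l).
Proof.
have -> : (fun p => ((rowof p)^t*) k l) = (fun p => (rowof p l k)^*).
  by apply/funext => p; rewrite !mxE.
exact/ccontinuousJ.
Qed.

Let feasible d : set Xn :=
  [set p | steklov_mx d (mxof p) /\ last_orthonormal (mxof p) (rowof p)].

Let closed_feasible d : closed (feasible d).
Proof.
have cst := ccontinuous_cst.
rewrite /feasible (_ : [set p | _] =
  [set p | (mxof p)^t* = mxof p] `&` ([set p | mxof p 0 0 = 1] `&`
  ([set p | forall k l k' l' : 'I_n.+1, (k + l' == k' + l)%N ->
      mxof p k l = mxof p k' l'] `&`
  ([set p | forall x : 'rV_n.+1,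
     d%:C%C * (x *m x^t*) 0 0 <= (x *m mxof p *m x^t*) 0 0] `&`
  ([set p | (rowof p *m mxof p *m (rowof p)^t*) 0 0 = 1] `&`
   [set p | forall j : 'I_n.+1, (j < n)%N -> (rowof p *m mxof p) 0 j = 0]))))); last first.
  apply/seteqP; split=> p /=.
    case=> -[? ? tp ?] [? ?].
    have tp' (k l k' l' : 'I_n.+1) : (k + l' == k' + l)%N -> mxof p k l = mxof p k' l'.
      by move/eqP; exact: tp.
    by do 5!apply: conj => //.
  case=> ? [? [tp [? [? ?]]]]; split; split => // k l k' l' e; apply: tp; exact/eqP.
apply: closedI.
  rewrite (_ : [set p | (mxof p)^t* = _] =
    [set p | forall i j, ((mxof p) j i)^* = (mxof p) i j]).
    do 2!apply: closed_forall => ?.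
    by apply: closed_ceq; [exact: ccontinuousJ|].
  apply/seteqP; split => p /=; [move=> /matrixP h i j|move=> h].
    by rewrite -[in RHS]h !mxE.
  by apply/matrixP => i j; rewrite -h !mxE.
apply: closedI; first exact: closed_ceq.
apply: closedI.
  by do 4!apply: closed_forall => ?; apply: closed_imply => _; exact: closed_ceq.
apply: closedI.
  apply: closed_forall => x; apply: closed_cle => //.
  by do 2!(apply: ccontinuous_mulmx => //).
apply: closedI.
  by apply: closed_ceq => //; do 2!(apply: ccontinuous_mulmx => //).
apply: closed_forall => j; apply: closed_imply => _.
by apply: closed_ceq => //; apply: ccontinuous_mulmx.
Qed.

Let feasible_id d : d <= 1 -> feasible d (code 1%:M (delta_mx 0 ord_max)).
Proof.
move=> d1; rewrite /feasible /= mxof_code rowof_code; split; split.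
- by rewrite trmx1 map_mx1.
- by rewrite mxE.
- move=> k l k' l' e; rewrite !mxE -!val_eqE /=; congr (_ %:R).
  by rewrite -(eqn_add2r l') e addnC eqn_add2l eq_sym.
- move=> x; rewrite mulmx1 ler_piMl ?gram_ge0//.
  by rewrite -[1]/(1%:C%C) lecR.
- by rewrite mulmx1 gram_row0E (bigD1 ord_max)//= big1 => [|i /negbTE ni];
    rewrite mxE ?ni ?andbF ?eqxx /= ?normr1 ?normr0 ?expr0n ?expr1n ?addr0.
- by move=> j jn; rewrite mulmx1 mxE eqxx /= -val_eqE /= ltn_eqF.
Qed.

Let compact_feasible d : 0 < d -> compact (feasible d).
Proof.
move=> d0; pose b (i : I) : R := if i is inl _ then 1 else 1 + d^-1.
apply: (@subclosed_compact _ _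
    [set p : Xn | forall i, [set` `[- b i, b i]] (p i)]) => //.
  apply: (@tychonoff I (fun=> R) (fun i => [set` `[- b i, b i]])) => i.
  exact: segment_compact.
move=> p [Tp ap] i /=; rewrite in_itv /= -ler_norml.
have d0' := ltW d0.
have leRe (z : R[i]) (r : R) : `|z| <= r%:C%C -> `|complex.Re z| <= r.
  by move=> zr; rewrite -lecR; apply: le_trans (normc_ge_Re z) zr.
have leIm (z : R[i]) (r : R) : `|z| <= r%:C%C -> `|complex.Im z| <= r.
  move=> zr; rewrite -lecR; apply: le_trans zr; case: z => x y.
  by rewrite norm_normc lecR /= -sqrtr_sqr ler_wsqrtr// lerDr sqr_ge0.
case: i => [[[[] k] l]|[[] j]].
- by have := leIm _ 1 (steklov_mx_le1 k l d0' Tp); rewrite mxE.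
- by have := leRe _ 1 (steklov_mx_le1 k l d0' Tp); rewrite mxE.
- by have := leIm _ _ (last_orthonormal_bound j d0 Tp ap); rewrite mxE.
- by have := leRe _ _ (last_orthonormal_bound j d0 Tp ap); rewrite mxE.
Qed.

(** A continuous function on the nonempty compact set of admissible pairs attains
    its maximum; the identity matrix with the last basis vector shows that the
    set is not empty. *)
Lemma extremal_pair d : 0 < d -> d <= 1 ->
  exists T a, [/\ steklov_mx d T, last_orthonormal T a &
    forall T' a', steklov_mx d T' -> last_orthonormal T' a' ->
      `|\sum_j a' 0 j| <= `|\sum_j a 0 j|].
Proof.
move=> d0 d1.
pose f (p : Xn) := ComplexField.Normc.normc (\sum_j rowof p 0 j).
have [||p /set_mem [Tp ap] pmax] :=
    @compact_EVT_max Xn R f (feasible d) _ (compact_feasible d0).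
- by exists (code 1%:M (delta_mx 0 ord_max)); exact: feasible_id.
- apply: continuous_subspaceT => x; apply: ccontinuous_normc.
  by apply: ccontinuous_sum.
exists (mxof p), (rowof p); split=> // T' a' HT' Ha'.
have := pmax (code T' a'); rewrite inE /f rowof_code !norm_normc lecR; apply.
by rewrite /feasible /= mxof_code rowof_code.
Qed.

End Extremal.

(** * Rotation, uniqueness and existence *)

Section ExtremalOnCircle.
Variables (R : realType) (n : nat).
Implicit Types (d : R) (T : 'M[R[i]]_n.+1) (a : 'rV[R[i]]_n.+1).

(** Acting on coefficient vectors, [rot z] turns [p] into the polynomial with
    values [p (z * x)]; on measures it corresponds to a rotation. *)
Let rot (z : R[i]) : 'M[R[i]]_n.+1 := diag_mx (\row_j z ^+ j).

Let rotK z : `|z| = 1 -> rot z *m (rot z)^t* = 1%:M.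
Proof.
move=> z1; rewrite /rot tr_diag_mx map_diag_mx mulmx_diag -diag_const_mx.
congr diag_mx; apply/rowP => j; rewrite !mxE -normCK normrX z1 expr1n.
by rewrite expr1n.
Qed.

Lemma steklov_mx_rot d T z : `|z| = 1 -> steklov_mx d T ->
  steklov_mx d ((rot z)^t* *m T *m rot z).
Proof.
move=> z1 [hT T1 toepT Td].
have zz : z^* * z = 1 by rewrite mulrC -normCK z1 expr1n.
have rTE k l : ((rot z)^t* *m T *m rot z) k l = (z^* ^+ k * z ^+ l) * T k l.
  rewrite /rot tr_diag_mx map_diag_mx mul_mx_diag mxE mul_diag_mx !mxE.
  by rewrite rmorphXn; ring.
have rk : rot z *m (rot z)^t* = 1%:M by exact: rotK.
have kr : (rot z)^t* *m rot z = 1%:M by exact: mulmx1C.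
split.
- by rewrite !trmxC_mul trmxCK hT mulmxA.
- by rewrite rTE !expr0 !mul1r.
- move=> k l k' l' e; rewrite !rTE (toepT _ _ _ _ e); congr (_ * _).
  have zn (m : nat) : z ^+ m != 0.
    by rewrite expf_neq0// -normr_eq0 z1 oner_eq0.
  have C m : z^* ^+ m = (z ^+ m)^-1.
    by apply: (mulIf (zn m)); rewrite -exprMn zz expr1n mulVf.
  rewrite !C mulrC [RHS]mulrC; apply/eqP; rewrite eqr_div ?zn// -!exprD.
  by rewrite [(l + k')%N]addnC -e addnC.
- move=> x; have := Td (x *m (rot z)^t*).
  by rewrite trmxC_mul trmxCK !mulmxA -(mulmxA x) kr mulmx1.
Qed.

Lemma last_orthonormal_rot T a z : `|z| = 1 -> last_orthonormal T a ->
  last_orthonormal ((rot z)^t* *m T *m rot z) (a *m rot z).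
Proof.
move=> z1 [a1 a0]; have rk : rot z *m (rot z)^t* = 1%:M by exact: rotK.
have E : a *m rot z *m ((rot z) ^t* *m T *m rot z) = a *m T *m rot z.
  by rewrite !mulmxA -(mulmxA a) rk mulmx1.
split; first by rewrite E trmxC_mul mulmxA -(mulmxA _ (rot z)) rk mulmx1.
by move=> j jn; rewrite E /rot mul_mx_diag mxE a0// mul0r.
Qed.

(** Rotating a pair by [z] keeps it admissible and moves the value at [z] to the
    point [1], so the bound of [extremal_pair] holds on the whole circle. *)
Lemma extremal_pair_circle d : 0 < d -> d <= 1 ->
  exists T a, [/\ steklov_mx d T, last_orthonormal T a &
    forall T' a' z, `|z| = 1 -> steklov_mx d T' -> last_orthonormal T' a' ->
      `|\sum_j a' 0 j * z ^+ j| <= `|\sum_j a 0 j|].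
Proof.
move=> d0 d1; have [T [a [dT aT Tmax]]] := extremal_pair n d0 d1.
exists T, a; split=> // T' a' z z1 dT' aT'.
have := Tmax _ _ (steklov_mx_rot z1 dT') (last_orthonormal_rot z1 aT').
congr (`| _ | <= _); apply: eq_bigr => j _.
by rewrite /rot mul_mx_diag !mxE.
Qed.

Lemma steklov_mx_ker d T a : 0 < d -> steklov_mx d T -> a *m T = 0 -> a = 0.
Proof.
move=> d0 [_ _ _ /(_ a)] + aT; rewrite aT mul0mx [leRHS]mxE => ale0.
apply: gram_eq0; apply/matrixP => i j; rewrite !ord1 [RHS]mxE.
apply/eqP; rewrite eq_le gram_ge0 andbT.
by move: ale0; rewrite pmulr_rle0// ltcR.
Qed.

(** Both [a T] and [a' T] are multiples of the last basis vector and [T] is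
    nonsingular, so [a] and [a'] are proportional, and their equal norms make the
    factor of modulus one. *)
Lemma last_orthonormal_unique d T a a' : 0 < d -> steklov_mx d T ->
  last_orthonormal T a -> last_orthonormal T a' ->
  exists2 c, `|c| = 1 & a' = c *: a.
Proof.
move=> d0 dT [a1 a0] [a'1 a'0].
pose s := (a *m T) 0 ord_max; pose s' := (a' *m T) 0 ord_max.
have aT (b : 'rV_n.+1) : (forall j : 'I_n.+1, (j < n)%N -> (b *m T) 0 j = 0) ->
    b *m T = (b *m T) 0 ord_max *: delta_mx 0 ord_max.
  move=> b0; apply/rowP => j; rewrite [RHS]mxE [delta_mx _ _ _ _]mxE eqxx /=.
  have [jn|nj] := ltnP j n; first by rewrite b0// -val_eqE /= ltn_eqF// mulr0.
  have -> : j = ord_max by apply/val_inj/anti_leq; rewrite nj -ltnS ltn_ord.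
  by rewrite eqxx mulr1.
have s0 : s != 0.
  apply/eqP => s0; move: a1; rewrite (aT _ a0) -/s s0 scale0r mul0mx mxE => /esym/eqP.
  by rewrite oner_eq0.
have : s *: a' - s' *: a = 0.
  apply: (steklov_mx_ker d0 dT); rewrite mulmxBl -!scalemxAl.
  by rewrite (aT _ a0) (aT _ a'0) -/s -/s' !scalerA mulrC subrr.
move/eqP; rewrite subr_eq0 => /eqP E.
have a'E : a' = (s' / s) *: a.
  by rewrite mulrC -scalerA -E scalerA mulVf// scale1r.
exists (s' / s) => //; move: a'1; rewrite a'E; set c := s' / s.
have -> : (c *: a) ^t* = c^* *: a^t*.
  by apply/matrixP => i j; rewrite !mxE rmorphM.
rewrite -!scalemxAl -scalemxAr scalerA mxE a1.
by rewrite mulr1 -normCK => /eqP; rewrite sqrp_eq1// => /eqP.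
Qed.

(** The last row [b] of the inverse of [T] is orthogonal to the lower powers.  Its
    squared norm is the conjugate of its last entry, so that this entry is
    positive and normalizing by its square root keeps it so. *)
Lemma last_orthonormal_exists d T : 0 < d -> steklov_mx d T ->
  exists2 a, last_orthonormal T a & 0 < a 0 ord_max.
Proof.
move=> d0 dT; have Tu : T \in unitmx.
  rewrite -row_free_unit -kermx_eq0; apply/eqP/row_matrixP => i.
  rewrite row0; apply: (steklov_mx_ker d0 dT).
  by apply/sub_kermxP; exact: row_sub.
pose e : 'rV[R[i]]_n.+1 := delta_mx 0 ord_max.
pose b := e *m invmx T.
have bT : b *m T = e by rewrite mulmxKV.
have bb : (b *m T *m b^t*) 0 0 = (b 0 ord_max)^*.
  by rewrite bT -rowE !mxE.
have bT0 : 0 < (b *m T *m b^t*) 0 0.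
  case: dT => _ _ _ /(_ b); apply: lt_le_trans.
  rewrite mulr_gt0 ?ltcR// lt_def gram_ge0 andbT.
  apply: contraTneq isT => bb0; have : b = 0.
    by apply: gram_eq0; apply/matrixP => i j; rewrite !ord1 bb0 mxE.
  move=> b0; move: bT; rewrite b0 mul0mx => /matrixP/(_ 0 ord_max).
  by rewrite !mxE !eqxx => /esym/eqP; rewrite oner_eq0.
set m := b 0 ord_max in bb.
have m0 : 0 < m by rewrite -(conjCK m) -bb geC0_conj ?ltW.
pose r := (sqrtC m)^-1.
have r0 : 0 < r by rewrite invr_gt0 sqrtC_gt0.
exists (r *: b); last by rewrite mxE -/m mulr_gt0.
split=> [|j jn]; last first.
  by rewrite -scalemxAl bT !mxE eqxx -val_eqE /= (ltn_eqF jn) mulr0.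
have -> : (r *: b) ^t* = r *: b^t*.
  by apply/matrixP => i j; rewrite !mxE rmorphM [X in X * _]geC0_conj ?ltW.
rewrite -!scalemxAl -scalemxAr scalerA mxE bb geC0_conj ?ltW//.
by rewrite /r -invfM -expr2 sqrtCK mulVf// gt_eqF.
Qed.
End ExtremalOnCircle.

(** * Integration over the circle *)

Section Expi.
Variable R : realType.
Implicit Types (s t : R).

Lemma expi0 : expi (0 : R) = 1.
Proof. by rewrite /expi cos0 sin0. Qed.

Lemma expiD s t : expi (s + t) = expi s * expi t.
Proof. by rewrite /expi cosD sinD [X in (_ +i* X)%C]addrC. Qed.

Lemma expiN t : expi (- t) = (expi t)^*.
Proof. by rewrite /expi cosN sinN. Qed.

Lemma expiX t k : expi t ^+ k = expi (k%:R * t).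
Proof.
elim: k => [|k IHk]; first by rewrite expr0 mul0r expi0.
by rewrite exprS IHk -expiD -[in RHS]natr1 mulrDl mul1r addrC.
Qed.

Lemma norm_expi t : `|expi t| = 1.
Proof. by rewrite norm_normc /expi /= cos2Dsin2 sqrtr1. Qed.

Lemma expi_monomial t k l : expi t ^+ k * (expi t ^+ l)^* = expi ((k%:R - l%:R) * t).
Proof. by rewrite !expiX -expiN -expiD mulrBl. Qed.

Lemma sin_natpi k : sin (k%:R * pi) = 0 :> R.
Proof.
elim: k => [|k IHk]; first by rewrite mul0r sin0.
by rewrite -natr1 mulrDl mul1r sinD IHk sinpi mul0r mulr0 addr0.
Qed.

Lemma unit_complex_expi (z : R[i]) : `|z| = 1 -> exists2 t, circle R t & expi t = z.
Proof.
case: z => x y; rewrite norm_normc => -[] /(congr1 (fun u => u ^+ 2)).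
rewrite expr1n sqr_sqrtr ?addr_ge0 ?sqr_ge0// => xy.
have x1 : -1 <= x <= 1 by apply/andP; split; nra.
have [y0|y0] := leP 0 y.
  exists (acos x); last first.
    rewrite /expi acosK ?in_itv//= sin_acos// -xy addrC addKr sqrtr_sqr.
    by rewrite ger0_norm.
  rewrite /circle /= in_itv /= acos_lepi// andbT (lt_le_trans _ (acos_ge0 x1))//.
  by rewrite oppr_lt0 pi_gt0.
(* The angle is not [- pi], which the circle excludes, because [x] is not [-1]. *)
exists (- acos x); last first.
  rewrite expiN /expi acosK ?in_itv//= sin_acos// -xy addrC addKr sqrtr_sqr.
  by rewrite ltr0_norm// -conjcE /= opprK.
rewrite /circle /= in_itv /= ltrN2 acos_ltpi ?(le_trans _ (pi_ge0 R))//.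
  by rewrite oppr_le0 acos_ge0.
by case/andP: x1 => x1 ->; rewrite andbT lt_def x1 andbT; apply/eqP; nra.
Qed.

Lemma ccontinuous_expi : ccontinuous (@expi R).
Proof. by split => t; [exact: continuous_cos|exact: continuous_sin]. Qed.

End Expi.

Section CircleIntegral.
Variable R : realType.
Local Notation cmeasure := {measure set (measurableTypeR R) -> \bar R}.
Local Notation D := (circle R).
Implicit Types (m : cmeasure) (F G : R[i] -> R[i]) (f g : R -> R).

Lemma continuous_integrable_circle m f : (m D < +oo)%E -> continuous f ->
  m.-integrable D (EFin \o f).
Proof.
move=> mD cf; apply: measurable_bounded_integrable => //.
- exact: measurable_circle.
- by apply: measurable_funTS; exact: continuous_measurable_fun.
have : bounded_set (f @` `[- pi, pi]).
  apply: compact_bounded; apply: continuous_compact; last exact: segment_compact.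
  exact: continuous_subspaceT.
move=> [M [Mr fM]]; exists M; split=> // r Mltr t /= Dt.
apply: (fM _ Mltr); exists t => //.
by move: Dt; rewrite /circle /= !in_itv /= => /andP[/ltW -> ->].
Qed.

Definition circle_continuous F := ccontinuous (fun t => F (expi t)).

Lemma circle_integralD m F G : (m D < +oo)%E ->
  circle_continuous F -> circle_continuous G ->
  circle_integral m (fun z => F z + G z) = circle_integral m F + circle_integral m G.
Proof.
move=> mD [F1 F2] [G1 G2]; rewrite /circle_integral.
apply/eqP; rewrite eq_complex /=; apply/andP; split; apply/eqP.
  under eq_Rintegral do rewrite Re_addc.
  by rewrite RintegralD; [|exact: measurable_circle|exact: continuous_integrable_circle..].
under eq_Rintegral do rewrite Im_addc.
by rewrite RintegralD; [|exact: measurable_circle|exact: continuous_integrable_circle..].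
Qed.

Lemma circle_integralZ m c F : (m D < +oo)%E -> circle_continuous F ->
  circle_integral m (fun z => c * F z) = c * circle_integral m F.
Proof.
move=> mD [F1 F2]; case: c => a b; rewrite /circle_integral.
have mc := measurable_circle R.
have I1 r := continuous_integrable_circle mD (f := fun t => r * complex.Re (F (expi t))).
have I2 r := continuous_integrable_circle mD (f := fun t => r * complex.Im (F (expi t))).
have {}I1 r : m.-integrable D (EFin \o (fun t => r * complex.Re (F (expi t)))).
  by apply: I1 => t; apply: cvgM; [exact: cvg_cst|exact: F1].
have {}I2 r : m.-integrable D (EFin \o (fun t => r * complex.Im (F (expi t)))).
  by apply: I2 => t; apply: cvgM; [exact: cvg_cst|exact: F2].
apply/eqP; rewrite eq_complex /=; apply/andP; split; apply/eqP.
  under eq_Rintegral do rewrite Re_mulc /=.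
  by rewrite RintegralB// !RintegralZl//; do ?exact: continuous_integrable_circle.
under eq_Rintegral do rewrite Im_mulc /=.
by rewrite RintegralD// !RintegralZl//; do ?exact: continuous_integrable_circle.
Qed.

Lemma circle_integral_eq m F G : (forall t, F (expi t) = G (expi t)) ->
  circle_integral m F = circle_integral m G.
Proof.
move=> FG; rewrite /circle_integral.
by congr (_ +i* _)%C; apply: eq_Rintegral => t _; rewrite FG.
Qed.

Lemma circle_integral_sum m (J : finType) (F : J -> R[i] -> R[i]) :
  (m D < +oo)%E -> (forall j, circle_continuous (F j)) ->
  circle_integral m (fun z => \sum_j F j z) = \sum_j circle_integral m (F j).
Proof.
move=> mD cF; rewrite -!big_enum /=.
suff /(_ (enum J)) : forall s : seq J, circle_continuous (fun z => \sum_(j <- s) F j z) /\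
  circle_integral m (fun z => \sum_(j <- s) F j z) = \sum_(j <- s) circle_integral m (F j).
  by move=> [_ <-]; apply: circle_integral_eq => t; rewrite big_enum.
elim=> [|j s [cs IHs]].
  split.
    by rewrite /circle_continuous; under eq_fun do rewrite big_nil; exact: ccontinuous_cst.
  rewrite big_nil (@circle_integral_eq _ _ (fun=> 0)); last by move=> t; rewrite big_nil.
  by rewrite /circle_integral /= Rintegral_cst ?mul0r//; exact: measurable_circle.
split.
  rewrite /circle_continuous; under eq_fun do rewrite big_cons.
  by apply: ccontinuousD => //; exact: cF.
rewrite big_cons -IHs -circle_integralD//.
by apply: circle_integral_eq => t; rewrite big_cons.
Qed.

Lemma circle_integralJ m F : (m D < +oo)%E -> circle_continuous F ->
  circle_integral m (fun z => (F z)^*) = (circle_integral m F)^*.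
Proof.
move=> mD [F1 F2]; rewrite /circle_integral; apply/eqP; rewrite eq_complex /=.
apply/andP; split; apply/eqP; first by under eq_Rintegral do rewrite Re_conjc.
under eq_Rintegral do rewrite Im_conjc -mulN1r.
rewrite RintegralZl ?mulN1r//; first exact: measurable_circle.
exact: continuous_integrable_circle.
Qed.

Lemma circle_integral1 m : circle_integral m (fun=> 1) = (fine (m D))%:C%C.
Proof.
by rewrite /circle_integral /= !Rintegral_cst ?mul0r ?mul1r//; exact: measurable_circle.
Qed.

(** Domination of measures passes to integrals of nonnegative functions; on
    [R[i]] the conclusion says that both sides have the same imaginary part, which
    is zero, and that the real parts are ordered. *)
Lemma le_circle_integral m1 m2 (c : {nonneg R}) F :
  (m1 D < +oo)%E -> (m2 D < +oo)%E ->
  (forall A, measurable A -> c%:num%:E * m1 A <= m2 A)%E ->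
  circle_continuous F -> (forall t, 0 <= F (expi t)) ->
  c%:num%:C%C * circle_integral m1 F <= circle_integral m2 F.
Proof.
move=> m1D m2D m12 [F1 F2] F0.
have ReF0 t : 0 <= complex.Re (F (expi t)) by have := F0 t; rewrite lecE => /andP[].
have ImF0 t : complex.Im (F (expi t)) = 0 by have := F0 t; rewrite lecE => /andP[/eqP].
rewrite /circle_integral.
have Im0 m : Rintegral m D (fun t => complex.Im (F (expi t))) = 0.
  under eq_Rintegral do rewrite ImF0.
  by rewrite Rintegral_cst ?mul0r//; exact: measurable_circle.
rewrite !Im0 complexr0 complexr0.
rewrite -rmorphM lecR -lee_fin.
have mc := measurable_circle R.
have mF : measurable_fun setT (EFin \o (fun t => complex.Re (F (expi t)))).
  by apply/measurable_EFinP; exact: continuous_measurable_fun.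
rewrite EFinM /Rintegral !fineK; last 2 first.
- by apply: integrable_fin_num => //; exact: continuous_integrable_circle.
- by apply: integrable_fin_num => //; exact: continuous_integrable_circle.
rewrite -ge0_integral_mscale//; last 2 first.
- exact: measurable_funTS.
- by move=> t _; rewrite lee_fin.
by apply: ge0_le_measure_integral => // t; rewrite lee_fin.
Qed.

Lemma circle_integral_measure_add m1 m2 F :
  (m1 D < +oo)%E -> (m2 D < +oo)%E -> circle_continuous F ->
  circle_integral (measure_add m1 m2) F = circle_integral m1 F + circle_integral m2 F.
Proof.
move=> m1D m2D [F1 F2].
have RD f : continuous f -> Rintegral (measure_add m1 m2) D f =
    Rintegral m1 D f + Rintegral m2 D f.
  move=> cf; have mc := measurable_circle R.
  have i1 := continuous_integrable_circle m1D cf.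
  have i2 := continuous_integrable_circle m2D cf.
  rewrite /Rintegral integral_measure_add//.
  by rewrite fineD// integrable_fin_num.
by rewrite /circle_integral !RD.
Qed.

Lemma circle_integral_mscale (k : {nonneg R}) m F :
  (m D < +oo)%E -> circle_continuous F ->
  circle_integral (mscale k m) F = k%:num%:C%C * circle_integral m F.
Proof.
move=> mD [F1 F2].
have RM f : continuous f -> Rintegral (mscale k m) D f = k%:num * Rintegral m D f.
  move=> cf; have mc := measurable_circle R.
  have i1 := continuous_integrable_circle mD cf.
  have mf : measurable_fun D (EFin \o f) by case/integrableP: i1.
  rewrite /Rintegral integralE [in RHS]integralE.
  rewrite !ge0_integral_mscale//; last 2 first.
  - exact: measurable_funeneg.
  - exact: measurable_funepos.
  rewrite -muleBr//; last first.
    by rewrite fin_num_adde_defr// integrable_pos_fin_num.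
  rewrite fineM// -integralE integrable_fin_num//.
by rewrite /circle_integral !RM//; simpc.
Qed.

Lemma circle_integral_dirac t F : D t -> circle_continuous F ->
  circle_integral (dirac (t : measurableTypeR R)) F = F (expi t).
Proof.
move=> Dt [F1 F2].
have RD f : continuous f -> Rintegral (dirac (t : measurableTypeR R)) D f = f t.
  move=> cf; rewrite /Rintegral integral_dirac; last 2 first.
  - exact: measurable_circle.
  - apply/measurable_EFinP; apply: measurable_funTS; exact: continuous_measurable_fun.
  by rewrite diracE mem_set// mul1e.
by rewrite /circle_integral !RD//; case: (F (expi t)).
Qed.

End CircleIntegral.

(** * Moment matrices of measures *)

Section Moments.
Variable R : realType.
Local Notation cmeasure := {measure set (measurableTypeR R) -> \bar R}.
Local Notation D := (circle R).
Implicit Types (m : cmeasure) (p q : {poly R[i]}).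

(** The Gram matrix of [1, z, ..., z^n] in [L^2 m]. *)
Definition moment_mx m n : 'M[R[i]]_n.+1 :=
  \matrix_(i, j) circle_integral m (fun z => z ^+ i * (z ^+ j)^*).

Lemma circle_continuous_exp k : circle_continuous (fun z : R[i] => z ^+ k).
Proof.
elim: k => [|k IHk].
  by rewrite /circle_continuous; under eq_fun do rewrite expr0; exact: ccontinuous_cst.
rewrite /circle_continuous; under eq_fun do rewrite exprS.
by apply: ccontinuousM => //; exact: ccontinuous_expi.
Qed.

Lemma circle_continuous_monomial k l :
  circle_continuous (fun z : R[i] => z ^+ k * (z ^+ l)^*).
Proof.
by apply: ccontinuousM; [|apply: ccontinuousJ]; exact: circle_continuous_exp.
Qed.

Lemma circle_continuous_horner p : circle_continuous (horner p).
Proof.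
rewrite /circle_continuous; under eq_fun do rewrite horner_coef.
apply: ccontinuous_sum => j; apply: ccontinuousM; first exact: ccontinuous_cst.
exact: circle_continuous_exp.
Qed.

Lemma circle_integral_horner m n p q : (m D < +oo)%E ->
  (size p <= n.+1)%N -> (size q <= n.+1)%N ->
  circle_integral m (fun z => p.[z] * (q.[z])^*) =
  (poly_rV p *m moment_mx m n *m (poly_rV q)^t*) 0 0.
Proof.
move=> mD pn qn.
transitivity (circle_integral m (fun z => \sum_(j < n.+1) \sum_(i < n.+1)
    (p`_i * (q`_j)^*) * (z ^+ i * (z ^+ j)^*))).
  apply: circle_integral_eq => t; rewrite (horner_coef_wide _ pn) (horner_coef_wide _ qn).
  rewrite rmorph_sum exchange_big /= big_distrl; apply: eq_bigr => i _ /=.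
  rewrite big_distrr; apply: eq_bigr => j _ /=.
  by rewrite rmorphM /= mulrACA.
have cc (i j : 'I_n.+1) : circle_continuous (fun z : R[i] =>
    p`_i * (q`_j)^* * (z ^+ i * (z ^+ j)^*)).
  apply: ccontinuousM; [exact: ccontinuous_cst|exact: circle_continuous_monomial].
rewrite circle_integral_sum// => [|j]; last by apply: ccontinuous_sum => i; exact: cc.
rewrite mxE; apply: eq_bigr => j _.
rewrite circle_integral_sum// mxE big_distrl; apply: eq_bigr => i _.
rewrite circle_integralZ//; last exact: circle_continuous_monomial.
by rewrite !mxE /= mulrAC.
Qed.

Lemma moment_mx_hermitian m n : (m D < +oo)%E -> (moment_mx m n)^t* = moment_mx m n.
Proof.
move=> mD; apply/matrixP => i j; rewrite !mxE -circle_integralJ//; last first.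
  exact: circle_continuous_monomial.
by apply: circle_integral_eq => t; rewrite rmorphM /= conjCK mulrC.
Qed.

(** On the circle, [z ^+ k * (z ^+ l)^*] depends on [k - l] only. *)
Lemma moment_mx_toeplitz m n (k l k' l' : 'I_n.+1) : (k + l' = k' + l)%N ->
  moment_mx m n k l = moment_mx m n k' l'.
Proof.
move=> e; rewrite !mxE; apply: circle_integral_eq => t.
rewrite !expi_monomial; congr (expi (_ * _)).
by apply/eqP; rewrite subr_eq addrAC eq_sym subr_eq -!natrD e.
Qed.

Lemma arc_length_circle : arc_length R D = (2 * pi)%:E.
Proof.
rewrite /arc_length /= /mrestr setIid lebesgue_measure_itv /= lte_fin.
by rewrite gtrN ?pi_gt0// -EFinB opprK mulr_natl mulr2n.
Qed.

(** The fundamental theorem of calculus, one endpoint being immaterial. *)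
Lemma Rintegral_arc_length (f F : R -> R) :
  continuous f -> (forall t : R, is_derive t 1 F (f t)) ->
  Rintegral (arc_length R) D f = F pi - F (- pi).
Proof.
move=> cf dF.
rewrite /Rintegral (eq_measure_integral lebesgue_measure); last first.
  by move=> A mA AD; rewrite /arc_length /= /mrestr setIidl.
rewrite integral_itv_obnd_cbnd; last first.
  by apply/measurable_EFinP; apply: measurable_funTS; exact: continuous_measurable_fun.
have cF : continuous F.
  by move=> t; apply/differentiable_continuous/derivable1_diffP; case: (dF t).
rewrite (@continuous_FTC2 _ f F)//.
- by rewrite gtrN ?pi_gt0.
- exact: continuous_subspaceT.
- split.
  + by move=> t _; case: (dF t).
  + by apply: cvg_at_right_filter; exact: cF.
  + by apply: cvg_at_left_filter; exact: cF.
- by move=> t _; rewrite derive1E; exact: derive_val.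
Qed.

Lemma moment_mx_arc_length n : moment_mx (arc_length R) n = (2 * pi)%:C%C%:M.
Proof.
apply/matrixP => k l; rewrite !mxE.
have [->|kl] := eqVneq k l.
  rewrite mulr1n (@circle_integral_eq _ _ _ (fun=> 1)) ?circle_integral1 ?arc_length_circle//.
  by move=> t; rewrite expi_monomial subrr mul0r expi0.
rewrite mulr0n.
set r : R := k%:R - l%:R.
have r0 : r != 0 by rewrite subr_eq0 eqr_nat.
have sinr : sin (r * pi) = 0.
  by rewrite mulrBl sinB !sin_natpi mulr0 mul0r subrr.
rewrite /circle_integral; apply/eqP; rewrite eq_complex /=; apply/andP; split; apply/eqP.
- under eq_Rintegral do rewrite expi_monomial -/r /expi /=.
  have dF (t : R) : is_derive t 1 (r^-1 \*: (sin \o (r \*: (@id R)))) (cos (r * t)).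
    by apply: is_derive_eq; rewrite /GRing.scale /= mulr1 mulrCA mulVf// mulr1.
  rewrite (@Rintegral_arc_length _ (fun t => r^-1 * sin (r * t)) _ dF).
    by rewrite mulrN sinN sinr oppr0 subrr.
  move=> t; apply: continuous_comp; last exact: continuous_cos.
  by apply: cvgM; [exact: cvg_cst|exact: cvg_id].
- under eq_Rintegral do rewrite expi_monomial -/r /expi /=.
  have dF (t : R) : is_derive t 1 ((- r^-1) \*: (cos \o (r \*: (@id R)))) (sin (r * t)).
    by apply: is_derive_eq; rewrite /GRing.scale /=; field.
  rewrite (@Rintegral_arc_length _ (fun t => - r^-1 * cos (r * t)) _ dF).
    by rewrite mulrN cosN subrr.
  move=> t; apply: continuous_comp; last exact: continuous_sin.
  by apply: cvgM; [exact: cvg_cst|exact: cvg_id].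
Qed.

(** The singular part is nonnegative, and the density is at least
    [delta / (2 * pi)] almost everywhere. *)
Lemma steklov_dominates (delta : R) (sigma : probability (measurableTypeR R) R) A :
  0 <= delta -> steklov delta sigma -> measurable A ->
  ((delta / (2 * pi))%:E * arc_length R A <= sigma A)%E.
Proof.
move=> d0 [_ [f [mf f0 [nu _ sigmaE]] df]] mA.
rewrite sigmaE// -[leLHS]adde0 leeD// -integral_cst//.
apply: ae_ge0_le_integral => //.
- by move=> t _; rewrite lee_fin divr_ge0// mulr_ge0// pi_ge0.
- by move=> t _; rewrite lee_fin.
- by apply/measurable_EFinP; exact: measurable_funTS.
- by apply: filterS df => t /= dt _; rewrite lee_fin.
Qed.

(** The quadratic form of the moment matrix at the coefficients of [p] is the
    integral of [|p|^2], which is at least [delta / (2 * pi)] times its integral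
    for arc length, that is, [delta] times the sum of the squared moduli of the
    coefficients. *)
Lemma steklov_moment_mx (delta : R) (sigma : probability (measurableTypeR R) R) n :
  0 <= delta -> steklov delta sigma -> steklov_mx delta (moment_mx sigma n).
Proof.
move=> d0 sS; have sD : sigma D = 1%E by case: sS.
have sDoo : (sigma D < +oo)%E by rewrite sD ltry.
have aDoo : (arc_length R D < +oo)%E by rewrite arc_length_circle ltry.
split.
- exact: moment_mx_hermitian.
- rewrite mxE (@circle_integral_eq _ _ _ (fun=> 1)) ?circle_integral1//.
    exact: (congr1 (fun u => (fine u)%:C%C) sD).
  by move=> t; rewrite !expr0 mul1r conjC1.
- exact: moment_mx_toeplitz.
move=> x; pose p := rVpoly x.
have px : x = poly_rV p by rewrite rVpolyK.
have pn : (size p <= n.+1)%N by rewrite size_poly.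
have c0 : 0 <= delta / (2 * pi) by rewrite divr_ge0// mulr_ge0// pi_ge0.
have := @le_circle_integral _ (arc_length R) sigma (NngNum c0)
  (fun z => p.[z] * (p.[z])^*) aDoo sDoo.
rewrite !(circle_integral_horner _ pn pn)// -px /= moment_mx_arc_length.
rewrite mul_mx_scalar -scalemxAl [X in _ * X <= _]mxE mulrA -rmorphM /= divfK; last first.
  by rewrite mulf_neq0 ?gt_eqF// pi_gt0.
apply.
- by move=> A mA; exact: steklov_dominates.
- apply: ccontinuousM; last apply: ccontinuousJ; exact: circle_continuous_horner.
- by move=> t; rewrite mul_conjC_ge0.
Qed.

End Moments.

(** * A measure in the Steklov class with given moments *)

Section ProbabilityOfMeasure.
Context d (T : measurableType d) (R : realType).

(** A copy of [m], to which the structure of probability is attached. *)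
Definition of_mass1 (m : {measure set T -> \bar R}) of m setT = 1%E :
  set T -> \bar R := m.

Variables (m : {measure set T -> \bar R}) (m1 : m setT = 1%E).

HB.instance Definition _ := Measure.copy (of_mass1 m1) m.

HB.instance Definition _ := Measure_isProbability.Build _ _ _ (of_mass1 m1) m1.

Definition probability_of_mass1 : probability T R := of_mass1 m1.

End ProbabilityOfMeasure.

Section Realization.
Variable R : realType.
Local Notation cmeasure := {measure set (measurableTypeR R) -> \bar R}.
Local Notation D := (circle R).

Fixpoint atoms (s : seq ({nonneg R} * R)) : cmeasure :=
  if s is (w, t) :: s' then
    measure_add (mscale w (dirac (t : measurableTypeR R))) (atoms s')
  else mzero.

Lemma atomsE s A : atoms s A = (\sum_(p <- s) p.1%:num%:E * \d_(p.2 : measurableTypeR R) A)%E.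
Proof.
elim: s => [|[w t] s IHs]; first by rewrite big_nil.
by rewrite big_cons -IHs; exact: measure_addE.
Qed.

Lemma atoms_mass s A : (forall p, p \in s -> A p.2) ->
  atoms s A = (\sum_(p <- s) p.1%:num)%:E.
Proof.
move=> sA; rewrite atomsE -sumEFin; apply: eq_big_seq => p ps.
by rewrite diracE mem_set ?mule1//; exact: sA.
Qed.

(** The finite set of nodes is null for arc length and carries [atoms s]. *)
Lemma atoms_singular s : mutually_singular (atoms s) (arc_length R).
Proof.
pose P : set R := [set` [seq p.2 | p <- s]].
have cP : countable P by exact/finite_set_countable/finite_seq.
have mP : measurable (P : set (measurableTypeR R)) by exact: countable_measurable.
exists (~` P); first exact: measurableC.
split; last first.
  rewrite setCK; apply/eqP; rewrite eq_le measure_ge0 andbT.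
  rewrite /arc_length /= /mrestr -(countable_lebesgue_measure0 cP).
  by apply: le_measure; rewrite ?inE//; apply: measurableI => //; exact: measurable_circle.
rewrite atomsE big1_seq// => p /= ps; rewrite diracE memNset ?mule0//=.
by apply; apply: map_f.
Qed.

Lemma circle_integral_atoms s F : (forall p, p \in s -> D p.2) ->
  circle_continuous F ->
  circle_integral (atoms s) F = \sum_(p <- s) p.1%:num%:C%C * F (expi p.2).
Proof.
elim: s => [|[w t] s IHs] sD cF.
  by rewrite big_nil /circle_integral /= /Rintegral !integral_measure_zero.
have Dt : D t by apply: (sD (w, t)); rewrite mem_head.
have {}sD p : p \in s -> D p.2 by move=> ps; apply: sD; rewrite inE ps orbT.
have dD : (dirac (t : measurableTypeR R) D < +oo :> \bar R)%E.
  by rewrite diracE ltry.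
rewrite big_cons; transitivity (circle_integral
    (measure_add (mscale w (dirac (t : measurableTypeR R))) (atoms s)) F) => //.
rewrite circle_integral_measure_add//; last 2 first.
- by apply: lte_mul_pinfty; rewrite ?lee_fin.
- by rewrite atoms_mass// ltry.
by rewrite circle_integral_mscale// circle_integral_dirac// IHs.
Qed.

(** Every admissible matrix is attained.  The measure is [delta / (2 * pi)] times
    arc length plus the point masses, of total mass [1 - delta], which the
    Caratheodory-Toeplitz theorem provides for the rest of [T]. *)
Lemma steklov_realization (delta : R) n (T : 'M[R[i]]_n.+1) :
  0 < delta -> delta < 1 -> steklov_mx delta T ->
  exists2 mu : probability (measurableTypeR R) R,
    steklov delta mu & moment_mx mu n = T.
Proof.
move=> d0 d1 [hT T1 toepT Td].
pose c : R[i] := ((1 - delta)%:C%C).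
have c0 : 0 < c by rewrite ltcR subr_gt0.
(* [T'] has unit diagonal, so the weights of its nodes add up to one. *)
pose T' := c^-1 *: (T - delta%:C%C%:M).
have TE : T = delta%:C%C%:M + c *: T'.
  by rewrite scalerA divff ?gt_eqF// scale1r addrC subrK.
have T'E k l : T' k l = c^-1 * (T k l - (delta%:C%C *+ (k == l))) by rewrite !mxE.
have [|||x|z [w [z1 w0 w1 T'w]]] := @toeplitz_psd_realization R n T'.
- apply/matrixP => i j; rewrite !mxE rmorphM rmorphB rmorphMn /= -[in RHS]hT !mxE.
  rewrite [c^-1^*]geC0_conj ?invr_ge0 ?ltW// [delta%:C%C^*]geC0_conj ?lecR ?ltW//.
  by rewrite eq_sym.
- by rewrite T'E T1 eqxx mulr1n /c rmorphB /= mulVf// -(rmorphB (real_complex R)) gt_eqF.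
- move=> k l k' l' e; rewrite !T'E (toepT _ _ _ _ e) -!val_eqE /=; congr (_ * (_ - _ *+ _)).
  by congr nat_of_bool; rewrite -(eqn_add2r l') e addnC eqn_add2l eq_sym.
- have -> : (x *m T' *m x^t*) 0 0 =
      c^-1 * ((x *m T *m x^t*) 0 0 - delta%:C%C * (x *m x^t*) 0 0).
    by rewrite /T' -scalemxAr -scalemxAl mulmxBr mulmxBl mul_mx_scalar -scalemxAl !mxE.
  by rewrite mulr_ge0 ?subr_ge0 ?Td// invr_ge0 ltW.
have [t Dt tz] : exists2 t : 'I_n.+1 -> R, forall j, D (t j) & forall j, expi (t j) = z j.
  have /choice[t tP] : forall j, exists t, D t /\ expi t = z j.
    by move=> j; have [t Dt tz] := unit_complex_expi (z1 j); exists t.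
  by exists t => j; case: (tP j).
have wR j : w j = (complex.Re (w j))%:C%C by rewrite RRe_real// ger0_real.
have wR0 j : 0 <= complex.Re (w j) by have := w0 j; rewrite wR lecR.
have v0 j : 0 <= (1 - delta) * complex.Re (w j).
  by rewrite mulr_ge0// subr_ge0 ltW.
pose s := [seq (NngNum (v0 j), t j) | j <- enum 'I_n.+1].
have sD p : p \in s -> D p.2 by case/mapP => j _ ->; exact: Dt.
have smass : \sum_(p <- s) p.1%:num = 1 - delta :> R.
  rewrite big_map big_enum /= -mulr_sumr -[RHS]mulr1; congr (_ * _).
  apply: complexI; rewrite rmorph_sum -[RHS]/(1 : R[i]) -w1.
  by apply: eq_bigr => j _; rewrite [RHS]wR.
have b0 : 0 <= delta / (2 * pi) by rewrite divr_ge0 ?(ltW d0)// mulr_ge0// pi_ge0.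
have pi2 : 2 * pi != 0 :> R by rewrite mulf_neq0// gt_eqF// pi_gt0.
pose b := NngNum b0.
pose mu0 : cmeasure := measure_add (mscale b (arc_length R)) (atoms s).
have arcT : arc_length R setT = (2 * pi)%:E.
  by rewrite -arc_length_circle /arc_length /= /mrestr setIid setTI.
have mu0E (A : set (measurableTypeR R)) : (D `<=` A) ->
    arc_length R A = (2 * pi)%:E -> mu0 A = 1%E.
  move=> DA aA; transitivity (b%:num%:E * arc_length R A + atoms s A)%E.
    exact: measure_addE.
  rewrite aA atoms_mass; last by move=> p /sD/DA.
  by rewrite smass -EFinM -EFinD /= divfK// addrC subrK.
have mu0T : mu0 setT = 1%E by exact: mu0E.
pose mu := probability_of_mass1 mu0T.
exists mu.
  split; first by apply: mu0E; [|exact: arc_length_circle].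
  exists (fun=> delta / (2 * pi)); last by apply: aeW => u.
  split; [exact: measurable_cst|by []|].
  exists (atoms s); first exact: atoms_singular.
  by move=> A mA; rewrite integral_cst//; exact: measure_addE.
have aD : (arc_length R D < +oo)%E by rewrite arc_length_circle ltry.
apply/matrixP => k l.
transitivity (circle_integral mu0 (fun z => z ^+ k * (z ^+ l)^*)); first by rewrite mxE.
have cF := @circle_continuous_monomial R k l.
rewrite circle_integral_measure_add//; last 2 first.
- by apply: lte_mul_pinfty; rewrite ?lee_fin.
- by rewrite atoms_mass// ltry.
rewrite circle_integral_mscale//.
have -> : circle_integral (arc_length R) (fun z => z ^+ k * (z ^+ l)^*) =
    moment_mx (arc_length R) n k l by rewrite mxE.
rewrite moment_mx_arc_length [in RHS]TE [in RHS]mxE; congr (_ + _).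
  by rewrite !mxE mulrnAr -rmorphM /= divfK.
rewrite circle_integral_atoms// big_map big_enum mxE T'w mulr_sumr.
by apply: eq_bigr => j _; rewrite [in RHS]wR -tz [RHS]mulrA -rmorphM.
Qed.

End Realization.

(** * Orthonormal polynomials *)

Section Polys.
Variable R : realType.
Local Notation cmeasure := {measure set (measurableTypeR R) -> \bar R}.
Local Notation D := (circle R).

Lemma positive_last_rVpoly n (a : 'rV[R[i]]_n.+1) :
  0 < a 0 ord_max -> size (rVpoly a) = n.+1 /\ lead_coef (rVpoly a) = a 0 ord_max.
Proof.
move=> a0; have an : (rVpoly a)`_n = a 0 ord_max by rewrite -(coef_rVpoly_ord a ord_max).
have sz : size (rVpoly a) = n.+1.
  apply/anti_leq; rewrite size_poly /= ltnNge; apply/negP => /leq_sizeP/(_ n (leqnn n)).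
  by rewrite an => an0; rewrite an0 ltxx in a0.
by rewrite lead_coefE sz.
Qed.

Lemma last_orthonormal_dot n (T : 'M[R[i]]_n.+1) (a b : 'rV[R[i]]_n.+1) :
  last_orthonormal T a -> b 0 ord_max = 0 -> (a *m T *m b^t*) 0 0 = 0.
Proof.
move=> [_ a0] b0; rewrite mxE big1// => j _; rewrite !mxE.
have [jn|nj] := ltnP j n; first by have := a0 _ jn; rewrite mxE => ->; rewrite mul0r.
have -> : j = ord_max by apply/val_inj/anti_leq; rewrite nj -ltnS ltn_ord.
by rewrite b0 conjC0 mulr0.
Qed.

(** For each degree [N], [last_orthonormal_exists] gives the coefficients of a
    polynomial of degree [N] orthogonal to all lower degrees, which makes
    distinct degrees orthogonal to each other. *)
Lemma steklov_orthonormal_polys (delta : R) (sigma : probability (measurableTypeR R) R) :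
  0 < delta -> steklov delta sigma -> is_orthonormal_polys sigma (orthonormal_poly sigma).
Proof.
move=> d0 sS; have sD : sigma D = 1%E by case: sS.
have sDoo : (sigma D < +oo)%E by rewrite sD ltry.
apply: (@xgetPex _ (fun=> 0) [set phi | is_orthonormal_polys sigma phi]).
have /choice[phi phiP] N : exists p : {poly R[i]}, exists a : 'rV[R[i]]_N.+1,
    [/\ p = rVpoly a, last_orthonormal (moment_mx sigma N) a & 0 < a 0 ord_max].
  have [a aH a0] := last_orthonormal_exists d0 (steklov_moment_mx N (ltW d0) sS).
  by exists (rVpoly a), a.
have phi_size N : size (phi N) = N.+1 /\ 0 < lead_coef (phi N).
  by have [a [-> aH a0]] := phiP N; have [-> ->] := positive_last_rVpoly a0.
exists phi; split => // k l.
pose B p q := circle_integral sigma (fun z => p.[z] * (q.[z])^*).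
have lt0 m n : (m < n)%N -> B (phi n) (phi m) = 0.
  move=> mn; rewrite /B (@circle_integral_horner _ sigma n) ?(phi_size _).1//; last first.
    exact: ltnW.
  have [a [-> aH a0]] := phiP n; rewrite rVpolyK.
  by apply: (last_orthonormal_dot aH); rewrite mxE nth_default// (phi_size m).1.
change (B (phi k) (phi l) = (k == l)%:R).
have [->|] := eqVneq k l.
  rewrite /B (@circle_integral_horner _ sigma l) ?(phi_size _).1//.
  by have [a [-> [aH _] _]] := phiP l; rewrite rVpolyK aH.
rewrite neq_ltn => /orP[kl|lk]; last exact: lt0.
rewrite -(conjCK (B _ _)) -[(B _ _)^*]circle_integralJ//; last first.
  by apply: ccontinuousM; [|apply: ccontinuousJ]; exact: circle_continuous_horner.
rewrite (@circle_integral_eq _ _ _ (fun z => (phi l).[z] * ((phi k).[z])^*)).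
  by rewrite -/(B (phi l) (phi k)) lt0// conjC0.
by move=> t; rewrite rmorphM /= conjCK mulrC.
Qed.

(** A polynomial of degree less than [n] is a combination of the lower orthonormal
    polynomials, by cancelling its leading term with the one of the same degree;
    hence [phi n] is orthogonal to the powers below [n]. *)
Lemma last_orthonormal_polys (sigma : cmeasure) (phi : nat -> {poly R[i]}) n :
  (sigma D < +oo)%E -> is_orthonormal_polys sigma phi ->
  last_orthonormal (moment_mx sigma n) (poly_rV (phi n)).
Proof.
move=> sDoo [phi_size phi_orth].
pose H := moment_mx sigma n.
pose B p q := (poly_rV p *m H *m (poly_rV q)^t*) 0 0.
have BE k : (k <= n)%N -> B (phi n) (phi k) = (n == k)%:R.
  move=> kn; rewrite -[RHS]phi_orth; apply/esym/circle_integral_horner => //.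
    by rewrite (phi_size n).1.
  by rewrite (phi_size k).1 ltnS.
split; first by have := BE n (leqnn n); rewrite eqxx.
have B0 k : (k <= n)%N -> forall q : {poly R[i]}, (size q <= k)%N -> B (phi n) q = 0.
  elim: k => [_|k IHk kn] q qk.
    move: qk; rewrite leqn0 size_poly_eq0 => /eqP ->.
    by rewrite /B linear0 trmx0 map_mx0 mulmx0 mxE.
  (* [r] is [q] with its term of degree [k] cancelled. *)
  pose c := q`_k / (phi k)`_k; pose r := q - c *: phi k.
  have lk : (phi k)`_k != 0.
    by have [sk] := phi_size k; rewrite lead_coefE sk /= => /gt_eqF ->.
  have rk : (size r <= k)%N.
    apply/leq_sizeP => j; rewrite leq_eqVlt => /predU1P[<-|kj].
      by rewrite coefB coefZ divfK// subrr.
    rewrite coefB coefZ !nth_default ?mulr0 ?subrr//.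
      by rewrite (phi_size k).1.
    exact: leq_trans kj.
  have -> : q = c *: phi k + r by rewrite addrC subrK.
  have -> : B (phi n) (c *: phi k + r) = c^* * B (phi n) (phi k) + B (phi n) r.
    rewrite /B linearD linearZ /= [in LHS]raddfD /= map_mxD mulmxDr mxE; congr (_ + _).
    by rewrite [in LHS]linearZ /= map_mxZ -scalemxAr mxE.
  by rewrite (IHk (ltnW kn) _ rk) addr0 (BE _ (ltnW kn)) (gtn_eqF kn) mulr0.
move=> j jn; have := B0 n (leqnn n) 'X^j; rewrite size_polyXn => /(_ jn).
rewrite /B mxE (bigD1 j)//= big1 => [|i ij].
  have -> : ((poly_rV 'X^j)^t* : 'M[R[i]]_(n.+1, 1)) j 0 = 1.
    by rewrite !mxE coefXn eqxx conjC1.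
  by rewrite addr0 mulr1.
by rewrite !mxE coefXn -val_eqE /= in ij *; rewrite (negbTE ij) conjC0 mulr0.
Qed.

Lemma horner_poly_rV n (p : {poly R[i]}) z : (size p <= n.+1)%N ->
  p.[z] = \sum_(j < n.+1) (poly_rV p : 'rV_n.+1) 0 j * z ^+ j.
Proof.
move=> pn; rewrite (horner_coef_wide _ pn).
by apply: eq_bigr => j _; rewrite mxE.
Qed.

End Polys.

(** * The essential supremum on the circle *)

Section EssSup.
Variable R : realType.

Lemma arc_length_setT : arc_length R setT = (2 * pi)%:E.
Proof. by rewrite -arc_length_circle /arc_length /= /mrestr setIid setTI. Qed.

Lemma Linfty_normE (F : R[i] -> R[i]) : Linfty_norm F =
  ess_sup (arc_length R) (fun t => (ComplexField.Normc.normc (F (expi t)))%:E).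
Proof.
rewrite /Linfty_norm unlock arc_length_setT lte_fin mulr_gt0 ?pi_gt0//.
congr ess_sup; apply/funext => t /=; rewrite ger0_norm//.
by case: (F (expi t)) => x y; exact: sqrtr_ge0.
Qed.

Lemma Linfty_norm_le (F : R[i] -> R[i]) (M : R) :
  (forall t, ComplexField.Normc.normc (F (expi t)) <= M) -> (Linfty_norm F <= M%:E)%E.
Proof. by move=> FM; rewrite Linfty_normE; apply/ess_supP/aeW => t; rewrite lee_fin. Qed.

(** If the essential supremum were below the value at [1], that is at angle [0],
    then by continuity a whole interval of angles would exceed it, and intervals
    are not null. *)
Lemma Linfty_norm_ge (F : R[i] -> R[i]) : circle_continuous F ->
  ((ComplexField.Normc.normc (F 1))%:E <= Linfty_norm F)%E.
Proof.
move=> cF; rewrite Linfty_normE leNgt; apply/negP.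
pose f t := ComplexField.Normc.normc (F (expi t)).
have cf : continuous f by exact: ccontinuous_normc.
rewrite -expi0 -/(f 0) => y0.
have [r yr rf] : exists2 r : R,
    (ess_sup (arc_length R) (fun t => (f t)%:E) <= r%:E)%E & r < f 0.
  case: (ess_sup _ _) y0 => [y| |]//.
    by rewrite lte_fin => yf; exists y.
  by move=> _; exists (f 0 - 1); rewrite ?leNye// ltrBlDr ltrDl.
have : \forall t \near (0 : R), r < f t.
  exact: (cvgr_gt _ (cf 0) _ rf).
move=> [e /= e0 fe].
have pi0 := pi_gt0 R.
(* Cutting at [pi] keeps the interval inside the circle. *)
pose e' : R := Num.min e pi.
have e'0 : 0 < e' by rewrite lt_min e0.
have /ess_supP[N [mN N0 Nf]] := yr.
pose I : set (measurableTypeR R) := [set` `]0, e'[].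
have sub : I `<=` N.
  move=> t; rewrite /I /= in_itv /= => /andP[t0 te]; apply: Nf => /=.
  apply/negP; rewrite -ltNge lte_fin; apply: fe.
  rewrite /= sub0r normrN gtr0_norm//.
  by rewrite (lt_le_trans te)// ge_min lexx.
have : (arc_length R I <= arc_length R N)%E.
  by apply: le_measure; rewrite ?inE//; exact: measurable_itv.
rewrite N0 /arc_length /= /mrestr setIidl; last first.
  move=> t; rewrite /I /circle /= !in_itv /= => /andP[t0 te].
  rewrite (lt_trans _ t0) ?oppr_lt0//= ltW//.
  by rewrite (lt_le_trans te)// ge_min lexx orbT.
by rewrite /I lebesgue_measure_itv /= lte_fin e'0 -EFinB subr0 lee_fin leNgt e'0.
Qed.

End EssSup.

(** * The extremal measure *)

Theorem theorem1p1 (R : realType) (n : nat) (delta : R)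
  (delta_gt0 : 0 < delta) (delta_lt1 : delta < 1) :
  exists2 mu : probability (measurableTypeR R) R,
    steklov delta mu &
    steklov_sup n delta =
      (ComplexField.Normc.normc (orthonormal_poly mu n).[1])%:E.
Proof.
have [T [a [dT aT Tmax]]] := extremal_pair_circle n delta_gt0 (ltW delta_lt1).
have [mu muS muT] := steklov_realization delta_gt0 delta_lt1 dT.
exists mu => //.
have orth (sigma : probability (measurableTypeR R) R) : steklov delta sigma ->
    size (orthonormal_poly sigma n) = n.+1 /\
    last_orthonormal (moment_mx sigma n) (poly_rV (orthonormal_poly sigma n)).
  move=> sS; have oS := steklov_orthonormal_polys delta_gt0 sS.
  split; first by case: oS => + _ => /(_ n)[].
  have sD : (sigma (circle R) < +oo)%E by case: sS => -> _; rewrite ltry.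
  exact: last_orthonormal_polys sD oS.
have [muz muo] := orth _ muS.
rewrite muT in muo.
have [c c1 phiE] := last_orthonormal_unique delta_gt0 dT aT muo.
have valE : `|(orthonormal_poly mu n).[1]| = `|\sum_j a 0 j|.
  rewrite (@horner_poly_rV _ n) ?muz// phiE.
  have -> : `|\sum_j a 0 j| = `|c * \sum_j a 0 j| by rewrite normrM c1 mul1r.
  rewrite mulr_sumr.
  by congr (`| _ |); apply: eq_bigr => j _; rewrite mxE expr1n mulr1.
have leval (sigma : probability (measurableTypeR R) R) t : steklov delta sigma ->
    ComplexField.Normc.normc (orthonormal_poly sigma n).[expi t] <=
    ComplexField.Normc.normc (orthonormal_poly mu n).[1].
  move=> sS; rewrite -lecR -!norm_normc valE.
  have [sz so] := orth _ sS; rewrite (@horner_poly_rV _ n) ?sz//.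
  apply: (Tmax _ _ _ (norm_expi t) _ so).
  exact: steklov_moment_mx (ltW delta_gt0) sS.
apply/eqP; rewrite eq_le; apply/andP; split.
  apply: ge_ereal_sup => _ [sigma sS <-]; apply: Linfty_norm_le => t.
  exact: leval.
apply: (le_trans (Linfty_norm_ge (circle_continuous_horner (orthonormal_poly mu n)))).
by apply: ereal_sup_ubound; exists mu.
Qed.
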